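(* Let $r,d\ge1$ be integers. There is a constant $c_{d,r}>0$ depending only on $d$ and $r$ such that the following holds. Let $A_1,\dots,A_d\subset\mathbb{R}$ be finite sets all of size $k\ge1$ which have distinct $d$-tuples of consecutive $r$--differences, and let $B_1,\dots,B_d\subset\mathbb{R}$ be nonempty finite sets of sizes $\ell_1,\dots,\ell_d$. Then $$|A_1+B_1|\cdots|A_d+B_d|\ge c_{d,r}\,\big(k^{dr+1}\,\ell_1\cdots\ell_d\big)^{1/(d(r+1))}.$$
   Context: Write $A_m=\{a_{m,1}<\dots<a_{m,k}\}$. The sets $A_1,\dots,A_d$ have distinct $d$-tuples of consecutive $r$--differences if the $(dr)$-tuples $$(a_{1,i+1}-a_{1,i},\dots,a_{1,i+r}-a_{1,i+r-1},\ \dots,\ a_{d,i+1}-a_{d,i},\dots,a_{d,i+r}-a_{d,i+r-1})$$ are pairwise distinct for $1\le i\le k-r$. $A+B=\{a+b:a\in A,b\in B\}$. *)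

(* Defs.v *)
From HB Require Import structures.
From mathcomp Require Import all_boot all_order all_algebra.
From mathcomp Require Import finmap.
From mathcomp Require Import reals exp.

Set Implicit Arguments.
Unset Strict Implicit.
Unset Printing Implicit Defensive.

Import Order.TTheory GRing.Theory Num.Theory.
Local Open Scope fset_scope.
Local Open Scope ring_scope.

Section SumsetsAndDifferences.
Context {R : realType}.

Definition sumset (A B : {fset R}) : {fset R} :=
  [fset a + b | a in A, b in B].

(* 0-based: [elt A i] is the (i+1)-st smallest element a_{i+1} of A;
   it is the junk value 0 when i >= #|` A|. *)
Definition elt (A : {fset R}) (i : nat) : R :=
  nth 0 (sort <=%O (enum_fset A)) i.

(* The (d r)-tuple of r consecutive differences starting at (0-based) index i,
   arranged as a d x r matrix with one row for each of the d sets. *)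
Definition consec_diffs (d r : nat) (A : 'I_d -> {fset R}) (i : nat) :
    'M[R]_(d, r) :=
  \matrix_(m < d, s < r) (elt (A m) (i + s).+1 - elt (A m) (i + s)).

(* For sets of common size k. The range 1 <= i <= k - r becomes i < k - r after
   shifting to 0-based indices; it is empty when k <= r, and otherwise every
   index used by [consec_diffs] is at most k - 1. *)
Definition distinct_consec_diffs (d r k : nat) (A : 'I_d -> {fset R}) : Prop :=
  forall i j : nat, (i < k - r)%N -> (j < k - r)%N -> i != j ->
    consec_diffs r A i <> consec_diffs r A j.

End SumsetsAndDifferences.

(* Main.v *)
(* Put C_m = A_m + B_m and N_m = |C_m|. For fixed b_m in B_m, the ranks in C_m of
   the elements a_{m,i} + b_m increase with i and stay below N_m, so only few i
   have a rank gap exceeding w_m ~ 2 d r N_m / (k - r) among the r consecutive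
   gaps starting at i. Hence for every (b_1, ..., b_d), at least half of the
   indices i have all their d r gaps at most w_m. Such a tuple (i, b_1, ..., b_d)
   is determined by the elements a_{m,i} + b_m of C_m and these gaps, since the
   consecutive differences determine i. Counting gives
   (k - r) l_1 ... l_d <= 2 prod_m N_m (w_m + 1)^r, that is,
   k^{dr+1} l_1 ... l_d <= K (N_1 ... N_d)^{r+1}, which is stronger than the
   theorem when d > 1. *)

Require Import Defs.
From HB Require Import structures.
From mathcomp Require Import all_boot all_order all_algebra.
From mathcomp Require Import finmap.
From mathcomp Require Import reals exp.

Set Implicit Arguments.
Unset Strict Implicit.
Unset Printing Implicit Defensive.

Import Order.TTheory GRing.Theory Num.Theory.
Local Open Scope fset_scope.
Local Open Scope ring_scope.

(** * Cardinality bounds for finite types and monotone sequences *)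

Lemma card_dffun (I : finType) (T : I -> finType) :
  #|{dffun forall i, T i}| = (\prod_i #|T i|)%N.
Proof. by rewrite card_dep_ffun foldrE big_map big_enum. Qed.

Lemma card_exists_leq (I J : finType) (P : J -> pred I) :
  (#|[set i | [exists j, P j i]]| <= \sum_j #|[set i | P j i]|)%N.
Proof.
rewrite cardsE -sum1_card big_mkcond /=.
under [leqRHS]eq_bigr => j _ do rewrite cardsE -sum1_card big_mkcond /=.
rewrite exchange_big /=; apply: leq_sum => i _.
rewrite unfold_in; case: ifP => // /existsP[j Pj].
by rewrite (bigD1 j) //= unfold_in Pj.
Qed.

(** Telescoping: each jump larger than [w] adds at least [w.+1] to the total increase. *)
Lemma card_big_jumps (f : nat -> nat) (n w : nat) :
  (forall i, (i < n)%N -> (f i <= f i.+1)%N) ->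
  (f 0 + #|[set i : 'I_n | w < f i.+1 - f i]| * w.+1 <= f n)%N.
Proof.
move=> f_mono; rewrite cardsE -sum1_card big_mkcond /= big_distrl /=.
elim: n f_mono => [|n IHn] f_mono; first by rewrite big_ord0 addn0.
rewrite big_ord_recr /= addnA.
have {}IHn := IHn (fun i Hi => f_mono i (ltnW Hi)).
apply: leq_trans (leq_add IHn (leqnn _)) _.
rewrite unfold_in /=; case: ifP => [w_lt|_].
  by rewrite mul1n -leq_subRL ?f_mono.
by rewrite mul0n addn0 f_mono.
Qed.

(** * Sorted elements, sumsets and ranks *)

Section Sumsets.
Context {R : realType}.
Implicit Types A B C : {fset R}.

Lemma elt_in A i : (i < #|` A|)%N -> elt A i \in A.
Proof. by move=> iA; rewrite -(mem_sort <=%O) mem_nth ?size_sort. Qed.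

Lemma elt_lt A i j : (i < j)%N -> (j < #|` A|)%N -> elt A i < elt A j.
Proof.
move=> ij jA; apply: sorted_ltn_nth => //; first exact: lt_trans.
- by rewrite sort_lt_sorted fset_uniq.
- by rewrite inE size_sort (ltn_trans ij).
- by rewrite inE size_sort.
Qed.

Lemma mem_sumset A B a b : a \in A -> b \in B -> a + b \in sumset A B.
Proof. by move=> aA bB; apply: in_imfset2. Qed.

Lemma leq_card_sumsetl A B : B != fset0 -> (#|` A| <= #|` sumset A B|)%N.
Proof.
case/fset0Pn=> b bB.
rewrite -(card_imfset imfset_key (mem A) (addIr b)) /=.
apply/fsubset_leq_card/fsubsetP => _ /imfsetP[a /= aA ->].
exact: mem_sumset.
Qed.

Lemma leq_card_sumsetr A B : A != fset0 -> (#|` B| <= #|` sumset A B|)%N.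
Proof.
case/fset0Pn=> a aA.
rewrite -(card_imfset imfset_key (mem B) (addrI a)) /=.
apply/fsubset_leq_card/fsubsetP => _ /imfsetP[b /= bB ->].
exact: mem_sumset.
Qed.

Definition rank C (x : R) : nat := count (fun y => y < x) (enum_fset C).

Lemma rank_leq_card C x : (rank C x <= #|` C|)%N.
Proof. exact: count_size. Qed.

Lemma rank_mono C x y : x <= y -> (rank C x <= rank C y)%N.
Proof. by move=> xy; apply: sub_count => z /= zx; apply: lt_le_trans xy. Qed.

Lemma rank_inj C : {in C &, injective (rank C)}.
Proof.
suff H x y : x \in C -> x < y -> rank C x <> rank C y.
  move=> x y xC yC xy; apply/eqP; case: ltgtP => // lt_xy.
    by case: (H _ _ xC lt_xy).
  by case: (H _ _ yC lt_xy).
move=> xC xy rank_xy.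
(* Elements below [x] are below [y], so equal counts make the two sets coincide; [x] lies in the
   second, giving [x < x]. *)
have: all (fun z => z < x) [seq z <- enum_fset C | z < y].
  rewrite all_count size_filter count_filter -[X in _ == X]rank_xy.
  apply/eqP/eq_count => z /=; apply: andb_idr => zx; exact: lt_trans xy.
by move/allP/(_ x); rewrite mem_filter xy ltxx => /(_ xC).
Qed.

End Sumsets.

(** * Encoding narrow pairs, then counting them twice *)

Section Counting.
Context {R : realType} (d r k : nat) (A B : 'I_d -> {fset R}).
Hypothesis cardA : forall m, #|` A m| = k.
Hypothesis distA : distinct_consec_diffs r k A.

Local Notation n := (k - r)%N.
Local Notation C m := (sumset (A m) (B m)).
Local Notation N m := #|` C m|.

Definition pos m (b : R) (i : nat) : nat := rank (C m) (elt (A m) i + b).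

(** By [pos_mono], the subtraction does not truncate when [i.+1 < k]. *)
Definition gap m (b : R) (i : nat) : nat := (pos m b i.+1 - pos m b i)%N.

Lemma pos_mono m b i : (i.+1 < k)%N -> (pos m b i <= pos m b i.+1)%N.
Proof.
by move=> ik; apply/rank_mono/ltW; rewrite ltrD2r elt_lt ?cardA.
Qed.

Variable w : 'I_d -> nat.

Definition narrow i (b : {dffun forall m, B m}) : bool :=
  [forall m, [forall s : 'I_r, (gap m (val (b m)) (i + s) <= w m)%N]].

Lemma shift_ltn (i : 'I_n) s : (s <= r)%N -> (i + s < k)%N.
Proof.
move=> sr; have := ltn_ord i; rewrite ltn_subRL addnC => /(leq_trans _)-> //.
by rewrite ltnS leq_add2l.
Qed.

Lemma elt_add_in m (i : 'I_n) s (b : B m) :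
  (s <= r)%N -> elt (A m) (i + s) + val b \in C m.
Proof.
by move=> sr; rewrite mem_sumset ?elt_in ?cardA ?shift_ltn ?fsvalP.
Qed.

Lemma elt_add_in0 m (i : 'I_n) (b : B m) : elt (A m) i + val b \in C m.
Proof. by have := @elt_add_in m i 0 b isT; rewrite addn0. Qed.

Local Notation target m := (C m * {ffun 'I_r -> 'I_(w m).+1})%type.

(* The first component determines the ranks of all the a_{m,i+s} + b_m together
   with the gaps, hence these r + 1 elements, their differences, i, and then b. *)
Definition code (p : 'I_n * {dffun forall m, B m}) :
    {dffun forall m, target m} :=
  [ffun m => ([` elt_add_in0 p.1 (p.2 m)],
              [ffun s : 'I_r => inord (gap m (val (p.2 m)) (p.1 + s))])].

Lemma code_inj : {in [pred p | narrow (val p.1) p.2] &, injective code}.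
Proof.
move=> [i b] [j b'] /= nib njb eq_code.
have code_eq m := congr1 (fun f : {dffun forall m, target m} => f m) eq_code.
have first_eq m : elt (A m) i + val (b m) = elt (A m) j + val (b' m).
  by have /(congr1 (val \o fst)) := code_eq m; rewrite !ffunE.
have gap_eq m (s : 'I_r) :
    gap m (val (b m)) (i + s) = gap m (val (b' m)) (j + s).
  have := code_eq m; rewrite !ffunE => /(congr1 snd)/ffunP/(_ s).
  (* Narrowness puts both gaps in the range where [inord] loses nothing. *)
  move=> /(congr1 val); rewrite !ffunE /= !inordK //.
    by move: njb => /forallP/(_ m)/forallP/(_ s).
  by move: nib => /forallP/(_ m)/forallP/(_ s).
(* A position is the initial one plus the gaps passed, hence induction on [s]. *)
have pos_eq m s : (s <= r)%N ->
    pos m (val (b m)) (i + s) = pos m (val (b' m)) (j + s).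
  elim: s => [|s IHs] sr; first by rewrite !addn0 /pos first_eq.
  have mono (h : 'I_n) c : (pos m c (h + s) <= pos m c (h + s).+1)%N.
    by apply: pos_mono; rewrite -addnS shift_ltn.
  rewrite !addnS -(subnKC (mono i _)) -(subnKC (mono j _)).
  by congr addn; [exact/IHs/ltnW | exact: (gap_eq m (Ordinal sr))].
have all_eq m s : (s <= r)%N ->
    elt (A m) (i + s) + val (b m) = elt (A m) (j + s) + val (b' m).
  move=> sr; apply: (@rank_inj _ (C m)); rewrite ?elt_add_in //.
  exact: pos_eq.
have ij : i = j.
  apply/val_inj/eqP/negPn/negP => /(distA (ltn_ord i) (ltn_ord j)); apply.
  apply/matrixP => m s; rewrite !mxE -!addnS.
  have := all_eq m s (ltnW (ltn_ord s)); have := all_eq m s.+1 (ltn_ord s).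
  have diffE (x y z : R) : x - y = (x + z) - (y + z).
    by rewrite opprD addrACA subrr addr0.
  by move=> e1 e0; rewrite (diffE _ _ (val (b m))) e1 e0 -diffE.
congr pair => //; apply/ffunP => m; apply/val_inj.
by have := first_eq m; rewrite ij => /addrI.
Qed.

Hypothesis dr_gt0 : (0 < d * r)%N.

Hypothesis w_large : forall m, (2 * (d * r) * N m < n * (w m).+1)%N.

(** For fixed [s] the positions increase with [i] and stay at most [N m], so at most
    [N m / (w m).+1] jumps are wide; [w_large] bounds this by [n / (2 d r)]. *)
Lemma card_wide m (b : B m) (s : 'I_r) :
  (2 * (d * r) * #|[set i : 'I_n | (w m < gap m (val b) (i + s))%N]| <= n)%N.
Proof.
pose f i := pos m (val b) (i + s).
set J := #|_|.
have f_mono i : (i < n)%N -> (f i <= f i.+1)%N.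
  by move=> i_n; rewrite /f addSn pos_mono // -addnS (shift_ltn (Ordinal i_n)).
have JN : (J * (w m).+1 <= N m)%N.
  apply: leq_trans (rank_leq_card (C m) (elt (A m) (n + s) + val b)).
  by apply: leq_trans (card_big_jumps (w m) f_mono); apply: leq_addl.
rewrite -(leq_pmul2r (ltn0Sn (w m))) -mulnA.
by apply: leq_trans (ltnW (w_large m)); rewrite leq_mul2l JN orbT.
Qed.

(** Union bound: each of the [d * r] pairs [(m, s)] excludes at most [n / (2 d r)] indices. *)
Lemma card_narrow (b : {dffun forall m, B m}) :
  (n <= 2 * #|[set i : 'I_n | narrow i b]|)%N.
Proof.
pose wide (p : 'I_d * 'I_r) (i : 'I_n) :=
  (w p.1 < gap p.1 (val (b p.1)) (i + p.2))%N.
have compl : ~: [set i : 'I_n | narrow i b] = [set i | [exists p, wide p i]].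
  apply/setP => i; rewrite !inE; apply/idP/existsP.
    rewrite negb_forall => /existsP[m]; rewrite negb_forall => /existsP[s].
    by rewrite -ltnNge; exists (m, s).
  case=> -[m s] wide_i; apply/negP => /forallP/(_ m)/forallP/(_ s).
  by move/(leq_trans wide_i); rewrite ltnn.
rewrite mul2n -addnn -[leqLHS](card_ord n).
rewrite -(cardsC [set i : 'I_n | narrow i b]).
rewrite leq_add2l -(leq_add2r #|~: [set i : 'I_n | narrow i b]|).
rewrite cardsC card_ord addnn -mul2n compl -(leq_pmul2l dr_gt0).
apply: (@leq_trans (\sum_(p : 'I_d * 'I_r) n)).
  rewrite mulnA (mulnC _ 2).
  apply: leq_trans (leq_mul (leqnn _) (card_exists_leq wide)) _.
  rewrite big_distrr /=.
  by apply: leq_sum => -[m s] _; apply: card_wide.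
by rewrite sum_nat_const card_prod !card_ord.
Qed.

(** Narrow pairs [(i, b)] are at least half of all pairs by [card_narrow], and at most as many as
    the codes by [code_inj]. *)
Lemma card_pairs_leq :
  (n * \prod_m #|` B m| <= 2 * \prod_m (N m * (w m).+1 ^ r))%N.
Proof.
have -> : (\prod_m (N m * (w m).+1 ^ r) = #|{dffun forall m, target m}|)%N.
  rewrite card_dffun; apply: eq_bigr => m _.
  by rewrite card_prod card_ffun !card_ord -cardfE.
have -> : (\prod_m #|` B m| = #|{dffun forall m, B m}|)%N.
  by rewrite card_dffun; apply: eq_bigr => m _; rewrite cardfE.
apply: leq_trans (leq_mul (leqnn 2) (leq_card_in _ _ code_inj)).
rewrite -sum1_card big_mkcond /=.
rewrite -(pair_bigA _
  (fun (i : 'I_n) (b : {dffun forall m, B m}) =>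
    if narrow i b then 1 else 0)%N) exchange_big /=.
rewrite mulnC -sum_nat_const big_distrr /=; apply: leq_sum => b _.
apply: leq_trans (card_narrow b) _.
by rewrite leq_mul2l /= cardsE -sum1_card big_mkcond.
Qed.

End Counting.

(** * Choice of the widths and the final inequality *)

Lemma sumset_diffs_bound (R : realType) (d r k : nat) (A B : 'I_d -> {fset R}) :
  (0 < d)%N -> (0 < r)%N -> (0 < k)%N -> (forall m, #|` A m| = k) ->
  distinct_consec_diffs r k A -> (forall m, B m != fset0) ->
  (k ^ (d * r + 1) * \prod_m #|` B m| <=
    2 * (r.+1 ^ (d * r + 1) * (3 * (d * r)) ^ (d * r)) *
      (\prod_m #|` sumset (A m) (B m)|) ^ r.+1)%N.
Proof.
(* In the constant, 2 comes from keeping half the pairs, powers of [r.+1] from [k <= r.+1 * n], and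
   powers of [3 * (d * r)] from [w_small]. *)
move=> d_gt0 r_gt0 k_gt0 cardA distA B_neq0.
set N := fun m => #|` sumset (A m) (B m)|.
have k_leN m : (k <= N m)%N by rewrite -(cardA m) leq_card_sumsetl.
have dr_gt0 : (0 < d * r)%N by rewrite muln_gt0 d_gt0.
(* If [k <= r], the constant absorbs the power of [k], and each [B m] is no larger than its
   sumset. *)
have [n0|n_gt0] := posnP (k - r).
  have k_ler : (k <= r.+1)%N by rewrite leqW // -subn_eq0 n0.
  apply: leq_mul.
    apply: (@leq_trans (r.+1 ^ (d * r + 1))); first by rewrite leq_exp2r ?addn1.
    by rewrite mulnCA leq_pmulr // muln_gt0 expn_gt0 muln_gt0 dr_gt0.
  apply: (@leq_trans (\prod_m N m)).
    apply: leq_prod => m _; apply: leq_card_sumsetr.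
    by rewrite -cardfs_gt0 cardA.
  rewrite expnS leq_pmulr // expn_gt0 prodn_gt0 // => m.
  exact: leq_trans (k_leN m).
set n := (k - r)%N in n_gt0.
(* The least width satisfying [w_large]. *)
pose w m := (2 * (d * r) * N m %/ n)%N.
have w_large m : (2 * (d * r) * N m < n * (w m).+1)%N.
  by rewrite [ltnRHS]mulnC ltn_ceil.
have w_small m : (n * (w m).+1 <= 3 * (d * r) * N m)%N.
  rewrite mulnS addnC (mulnC n).
  have n_le : (n <= d * r * N m)%N.
    apply: leq_trans (leq_subr _ _) (leq_trans (k_leN m) _).
    by rewrite leq_pmull.
  apply: leq_trans (leq_add (leq_trunc_div _ _) n_le) _.
  by rewrite -mulnDl -mulSnr.
have k_le : (k <= r.+1 * n)%N.
  have -> : k = (r + n)%N by rewrite subnKC // ltnW // -subn_gt0.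
  by rewrite mulSnr leq_add2r leq_pmulr.
apply: (@leq_trans ((r.+1 * n) ^ (d * r + 1) * \prod_m #|` B m|)).
  by rewrite leq_mul2r leq_exp2r ?addn1 // k_le orbT.
suff key : (n ^ (d * r + 1) * \prod_m #|` B m| <=
    2 * ((3 * (d * r)) ^ (d * r) * (\prod_m N m) ^ r.+1))%N.
  rewrite expnMn -mulnA -(mulnA 2) (mulnCA 2) -mulnA leq_mul2l.
  apply/orP; right.
  by rewrite mulnCA.
rewrite addn1 expnSr -mulnA.
have pairs := card_pairs_leq cardA distA dr_gt0 w_large.
apply: leq_trans (leq_mul (leqnn _) pairs) _.
rewrite mulnCA leq_mul2l /=.
(* Giving each [m] its own factor [n ^ r] produces [(n * (w m).+1) ^ r], to which [w_small]
   applies. *)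
have powE x : (x ^ (d * r) = \prod_(m < d) x ^ r)%N.
  by rewrite prod_nat_const card_ord -expnM mulnC.
rewrite !powE expnS -!big_split /=.
rewrite (big_morph (expn^~ r) (fun x y => expnMn x y r) (exp1n r)).
rewrite -!big_split /=.
apply: leq_prod => m _; rewrite mulnCA [leqRHS]mulnCA leq_mul2l -!expnMn.
by rewrite leq_exp2r // w_small orbT.
Qed.

Theorem theorem1p4 (R : realType) (r d : nat) (hr : (1 <= r)%N)
    (hd : (1 <= d)%N) :
  exists c : R, 0 < c /\
    forall (k : nat) (l : 'I_d -> nat) (A B : 'I_d -> {fset R}),
      (1 <= k)%N ->
      (forall m, #|` A m| = k) ->
      distinct_consec_diffs r k A ->
      (forall m, B m != fset0) ->
      (forall m, #|` B m| = l m) ->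
      c * (k%:R ^+ (d * r + 1) * \prod_(m < d) (l m)%:R)
            `^ (1 / (d * (r + 1))%:R)
        <= \prod_(m < d) #|` sumset (A m) (B m)|%:R.

Proof.
set e := 1 / (d * (r + 1))%:R.
set K := (2 * (r.+1 ^ (d * r + 1) * (3 * (d * r)) ^ (d * r)))%N.
have K_gt0 : (0 < K)%N by rewrite !(muln_gt0, expn_gt0) hr hd.
have D_gt0 : (0 < d * (r + 1))%N by rewrite muln_gt0 hd addn1.
exists (K%:R `^ e)^-1; split; first by rewrite invr_gt0 powR_gt0 // ltr0n.
move=> k l A B k_gt0 cardA distA B_neq0 cardB.
have bound := sumset_diffs_bound hd hr k_gt0 cardA distA B_neq0.
under eq_bigr => m _ do rewrite -cardB.
rewrite -!natr_prod; set P := (\prod_m #|` sumset (A m) (B m)|)%N in bound *.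
have P_gt0 : (0 < P)%N.
  apply: prodn_gt0 => m; apply: leq_trans k_gt0 _.
  by rewrite -(cardA m) leq_card_sumsetl.
rewrite mulrC ler_pdivrMr ?powR_gt0 ?ltr0n //.
(* With both sides written as [e]-th powers, monotonicity leaves an inequality between integers. *)
have -> : P%:R * K%:R `^ e = (K%:R * P%:R ^+ (d * (r + 1))) `^ e :> R.
  rewrite powRM ?exprn_ge0 // -powR_mulrn // -powRrM /e mul1r mulfV.
    by rewrite powRr1 // mulrC.
  by rewrite pnatr_eq0 -lt0n.
rewrite ge0_ler_powR ?nnegrE ?divr_ge0 ?mulr_ge0 ?exprn_ge0 ?prodr_ge0 //.
(* The bound has power r + 1 on P; as P >= 1, it may be raised to d * (r + 1). *)
rewrite -!natrX -!natrM ler_nat (leq_trans bound) // leq_mul2l.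
by rewrite leq_pexp2l ?orbT // addn1 leq_pmull.
Qed.
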